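(* Let $\mathcal H\cong\mathbb C^d$ and let $\mathbb B_0,\mathbb B_1,\mathbb B_2$ be bases of $\mathcal H$ with $\mathbb B_1\succ^{\mathbb B_0}\mathbb B_2$. Then $$q(\mathbb B_1,\mathbb B_0)\le q(\mathbb B_2,\mathbb B_0)\qquad\text{and}\qquad r^{(\mathrm{MU})}(\mathbb B_1,\mathbb B_0)\le r^{(\mathrm{MU})}(\mathbb B_2,\mathbb B_0),$$ where, for bases $\mathbb B,\mathbb B'$, $$q(\mathbb B,\mathbb B'):=1-\lambda_{\min}\big(X(\mathbb B,\mathbb B')X^T(\mathbb B,\mathbb B')\big),\qquad r^{(\mathrm{MU})}(\mathbb B,\mathbb B'):=-\log\Big(\max_{i,j}X_{ij}(\mathbb B,\mathbb B')\Big),$$ and $\lambda_{\min}$ denotes the minimum eigenvalue.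
   Context: A basis $\mathbb B$ of $\mathcal H\cong\mathbb C^d$ means a set $\mathbb B=\{P_i\}_{i=1}^d$ of rank-1 orthogonal projectors with $\sum_i P_i=I$. For bases $\mathbb B=\{P_i\}$, $\mathbb B'=\{P'_j\}$, $X(\mathbb B,\mathbb B')$ is the $d\times d$ bistochastic matrix with entries $X_{ij}(\mathbb B,\mathbb B')=\operatorname{Tr}(P_iP'_j)$ (defined up to the arbitrary enumeration of the bases). One writes $\mathbb B_1\succ^{\mathbb B_0}\mathbb B_2$ iff there is a bistochastic (doubly stochastic) matrix $M$ with $X(\mathbb B_2,\mathbb B_0)=M X(\mathbb B_1,\mathbb B_0)$. *)

(* Defs.v *)
From HB Require Import structures.
From mathcomp Require Export all_boot all_order all_algebra.
From mathcomp Require Export complex.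
From mathcomp Require Export boolp classical_sets reals exp.

Set Implicit Arguments.
Unset Strict Implicit.
Unset Printing Implicit Defensive.

Import Order.TTheory GRing.Theory Num.Theory.
Local Open Scope ring_scope.
Local Open Scope complex_scope.
Local Open Scope sesquilinear_scope.

(* H = C^d with its standard inner product.  [B ^t*] is the conjugate
   transpose, i.e. the adjoint.  The enumeration i |-> P_i is part of the data:
   the d projectors are pairwise distinct, because d of them of rank 1 sum to
   the identity. *)
Record basis (R : realType) (d : nat) := Basis {
  proj :> 'I_d -> 'M[R[i]]_d ;
  proj_idem : forall i, proj i *m proj i = proj i ;
  proj_adj : forall i, (proj i) ^t* = proj i ;
  proj_rank1 : forall i, \rank (proj i) = 1%N ;
  proj_sum : \sum_i proj i = 1%:M }.

(* Tr (P_i P'_j) is real; [Re] only serves to land in R. *)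
Definition overlap_mx (R : realType) (d : nat) (B B' : basis R d) : 'M[R]_d :=
  \matrix_(i, j) complex.Re (\tr (B i *m B' j)).

Definition bistochastic (R : realType) (d : nat) (M : 'M[R]_d) : Prop :=
  [/\ forall i j, 0 <= M i j,
      forall i, \sum_j M i j = 1
    & forall j, \sum_i M i j = 1].

(* [basis_succ B0 B1 B2] is B1 >^{B0} B2. *)
Definition basis_succ (R : realType) (d : nat) (B0 B1 B2 : basis R d) : Prop :=
  exists M : 'M[R]_d,
    bistochastic M /\ overlap_mx B2 B0 = M *m overlap_mx B1 B0.

(* The set is finite, and nonempty when A is symmetric and d > 0; [inf] is then
   its least element (see [lambda_minP]). *)
Definition lambda_min (R : realType) (d : nat) (A : 'M[R]_d) : R :=
  inf [set a | eigenvalue A a]%classic.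

Definition q (R : realType) (d : nat) (B B' : basis R d) : R :=
  1 - lambda_min (overlap_mx B B' *m (overlap_mx B B')^T).

(* The entries are nonnegative, so starting the maximum from 0 is harmless. *)
Definition overlap_max (R : realType) (d : nat) (B B' : basis R d) : R :=
  \big[Num.max/0]_(i < d) \big[Num.max/0]_(j < d) overlap_mx B B' i j.

Definition rMU (R : realType) (d : nat) (B B' : basis R d) : R :=
  - ln (overlap_max B B').

Lemma overlapE (R : realType) (d : nat) (B B' : basis R d) i j :
  0 <= overlap_mx B B' i j /\ \tr (B i *m B' j) = (overlap_mx B B' i j)%:C.
Proof.
have trE : \tr (B i *m B' j) = \tr ((B' j *m B i) *m (B' j *m B i) ^t*).
  rewrite trmx_mul map_mxM !proj_adj mulmxA -[B' j *m B i *m B i]mulmxA.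
  by rewrite proj_idem [RHS]mxtrace_mulC mulmxA proj_idem mxtrace_mulC.
have ge0 : 0 <= \tr (B i *m B' j).
  rewrite trE; apply: sumr_ge0 => k _; rewrite mxE; apply: sumr_ge0 => l _.
  by rewrite !mxE; exact: mul_conjC_ge0.
rewrite mxE; case: (\tr _) ge0 => x y /=; rewrite lecE /= => /andP[/eqP -> ->].
by [].
Qed.

Lemma min_root (R : realType) (p : {poly R}) :
  p != 0 -> (exists a, root p a) ->
  exists2 m, root p m & forall a, root p a -> m <= a.
Proof.
have [n] := ubnP (size p); elim: n p => // n IHn p; rewrite ltnS => sz p0 [a].
move=> /factor_theorem[r pE].
have r0 : r != 0 by apply: contraNneq p0 => r0; rewrite pE r0 mul0r.
have rootE b : root p b = (b == a) || root r b.
  by rewrite pE rootM root_XsubC orbC.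
have [[b rb]|nor] := pselect (exists b, root r b); last first.
  exists a => [|b]; first by rewrite rootE eqxx.
  by rewrite rootE => /orP[/eqP->//|rb]; case: nor; exists b.
have [|m rm mP] := IHn r _ r0 (ex_intro _ b rb).
  by apply: leq_trans sz; rewrite pE size_Mmonic ?monicXsubC // size_XsubC addn2.
exists (Num.min a m).
  by rewrite rootE; case: leP => _; rewrite ?eqxx ?rm ?orbT.
by move=> c; rewrite rootE ge_min => /orP[/eqP->|/mP->]; rewrite ?lexx ?orbT.
Qed.

Lemma sym_eigenvalue (R : realType) (d : nat) (A : 'M[R]_d) :
  (0 < d)%N -> A^T = A -> exists a, eigenvalue A a.
Proof.
move=> d0 AT; pose f := real_complex R.
have [c cA] := eigenvalue_closed (map_mx f A) d0.
have fAherm : (map_mx f A) ^t* = map_mx f A.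
  rewrite -[in RHS]AT; apply/matrixP => i j; rewrite !mxE.
  by apply/CrealP; rewrite complex_real.
have creal : c \is Num.real.
  have /eigenvalueP[v vA v0] := cA.
  have vv0 : (v *m v ^t*) 0 0 != 0.
    apply: contraNneq v0 => vv; apply/eqP/rowP => j; rewrite mxE.
    move: vv; rewrite mxE => /eqP; rewrite psumr_eq0; last first.
      by move=> k _; rewrite !mxE; exact: mul_conjC_ge0.
    by move=> /allP/(_ j (mem_index_enum j)); rewrite !mxE /= mul_conjC_eq0 => /eqP.
  have e1 : v *m map_mx f A *m v ^t* = c *: (v *m v ^t*).
    by rewrite vA scalemxAl.
  have e2 : v *m map_mx f A *m v ^t* = c^* *: (v *m v ^t*).
    rewrite -mulmxA -{1}fAherm -map_mxM -trmx_mul vA.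
    by rewrite linearZ /= map_mxZ scalemxAr.
  apply/CrealP; apply: (mulIf vv0).
  by have := congr1 (fun M : 'M_1 => M 0 0) (etrans (esym e1) e2); rewrite !mxE.
exists (complex.Re c); move: cA.
by rewrite -[c in eigenvalue _ c]RRe_real // -[_%:C]/(f _) eigenvalue_map.
Qed.

Lemma lambda_minP (R : realType) (d : nat) (A : 'M[R]_d) :
  (0 < d)%N -> A^T = A ->
  eigenvalue A (lambda_min A) /\
  (forall a, eigenvalue A a -> lambda_min A <= a).
Proof.
move=> d0 AT; have [a aA] := sym_eigenvalue d0 AT.
have [||m mA mP] := @min_root R (char_poly A).
- exact/monic_neq0/char_poly_monic.
- by exists a; rewrite -eigenvalue_root_char.
have mlb : lbound [set b | eigenvalue A b]%classic m.
  by move=> b /=; rewrite eigenvalue_root_char => /mP.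
suff -> : lambda_min A = m.
  by split => [|b /mlb//]; rewrite eigenvalue_root_char.
apply/eqP; rewrite eq_le; apply/andP; split.
  apply: ge_inf; first by exists m.
  by rewrite /= eigenvalue_root_char.
by apply: lb_le_inf => //; exists a.
Qed.

(* Main.v *)
(* Since X X^T and X^T X have the same eigenvalues, lambda_min (X X^T) is the
   minimum of |X v|^2 / |v|^2.  A bistochastic M contracts the Euclidean norm,
   so this quotient does not increase when X is replaced by M X.  Likewise the
   entries of M X are averages of entries of X, hence at most their maximum. *)
Require Import Defs.
From mathcomp Require Import spectral ring.
Set Implicit Arguments.
Unset Strict Implicit.
Unset Printing Implicit Defensive.
Import Order.TTheory GRing.Theory Num.Theory.
Local Open Scope ring_scope.
Local Open Scope complex_scope.
Local Open Scope sesquilinear_scope.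

(** A left eigenvector [v] of [A *m B] yields [v *m A] for [B *m A]. If [v *m A] vanishes, then
    [a = 0] and another vector killed by [B *m A] is needed. *)
Lemma eigenvalue_mulmxC (F : fieldType) (n : nat) (A B : 'M[F]_n) a :
  eigenvalue (A *m B) a -> eigenvalue (B *m A) a.
Proof.
case/eigenvalueP => v vAB v0; apply/eigenvalueP.
have [vA0|vA_neq0] := eqVneq (v *m A) 0; last first.
  by exists (v *m A); rewrite // mulmxA -(mulmxA v) vAB scalemxAl.
have a0 : a = 0.
  by move: vAB; rewrite mulmxA vA0 mul0mx => /esym/eqP;
     rewrite scaler_eq0 (negbTE v0) orbF => /eqP.
(* For invertible [B] take [v *m invmx B]; otherwise take a nonzero left kernel vector of [B]. *)
rewrite a0; have [Bu|] := boolP (B \in unitmx).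
  exists (v *m invmx B); first by rewrite mulmxA mulmxKV // vA0 scale0r.
  by apply: contraNneq v0 => vB0; rewrite -(mulmxKV Bu v) vB0 mul0mx.
rewrite unitmxE unitfE negbK => /det0P[u u0 uB].
by exists u; rewrite // mulmxA uB mul0mx scale0r.
Qed.

(** Row [i] of [spectralmx A] is a left eigenvector, nonzero because that matrix is invertible. *)
Lemma eigenvalue_spectral_diag (C : numClosedFieldType) (n : nat)
    (A : 'M[C]_n) i :
  A \is normalmx -> eigenvalue A (spectral_diag A 0 i).
Proof.
move=> /orthomx_spectralP AE; apply/eigenvalueP.
have Pu := spectral_unit A.
exists (row i (spectralmx A)).
  rewrite [X in _ *m X]AE !mulmxA -row_mul mulmxV // -row_mul mul1mx.
  by rewrite row_diag_mx -scalemxAl -rowE.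
apply: contraTneq Pu => r0; apply/negP => Pu.
have := congr1 (mulmx^~ (invmx (spectralmx A))) r0.
rewrite -row_mul mulmxV // mul0mx => /rowP/(_ i); rewrite !mxE eqxx => /eqP.
by rewrite oner_eq0.
Qed.

(** In the coordinates [w] of [v] in a unitary eigenbasis of the complexified [A], both sides are
    sums weighted by the squared moduli of the [w 0 k], and they compare term by term. *)
Lemma lambda_min_rayleigh (R : realType) (d : nat) (A : 'M[R]_d)
    (v : 'rV[R]_d) :
  (0 < d)%N -> A^T = A ->
  lambda_min A * (v *m v^T) 0 0 <= (v *m A *m v^T) 0 0.
Proof.
move=> d0 AT; have [_ minA] := lambda_minP d0 AT.
pose f := real_complex R; pose fA := map_mx f A; pose fv := map_mx f v.
have fadj m n (B : 'M[R]_(m, n)) : (map_mx f B)^t* = map_mx f B^T.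
  by apply/matrixP => i j; rewrite !mxE; apply/CrealP; rewrite complex_real.
have Aherm : fA \is hermsymmx.
  by apply/is_hermitianmxP; rewrite expr0 scale1r fadj AT.
have Anorm := hermitian_normalmx Aherm.
(* The spectrum of a hermitian matrix is real, so each diagonal entry comes from an eigenvalue of
   the real matrix [A], where minimality applies. *)
have Dmin i : f (lambda_min A) <= spectral_diag fA 0 i.
  have := eigenvalue_spectral_diag i Anorm.
  have /mxOverP/(_ 0 i) Dreal := hermitian_spectral_diag_real Aherm.
  rewrite -[spectral_diag _ 0 i]RRe_real // -[_%:C]/(f _) eigenvalue_map.
  by move=> /minA; rewrite lecR.
have fAE := orthomx_spectralP Anorm; have Punit := spectral_unitarymx fA.
set P := spectralmx fA in fAE Punit; set D := spectral_diag fA in fAE Dmin.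
have [w wP] : exists w, w = fv *m invmx P by exists (fv *m invmx P).
have wE : P *m map_mx f v^T = w^t*.
  by rewrite wP invmx_unitary // trmx_mul map_mxM fadj map_trmx trmxK
    -map_mx_comp (map_mx_id (@conjCK _)).
have normE : f ((v *m v^T) 0 0) = \sum_k w 0 k * Num.conj (w 0 k).
  transitivity (map_mx f (v *m v^T) 0 0); first by rewrite [RHS]mxE.
  rewrite map_mxM -/fv -(mulmxKV (unitarymx_unit Punit) fv) -wP -mulmxA wE mxE.
  by apply: eq_bigr => k _; rewrite !mxE.
have formE : f ((v *m A *m v^T) 0 0) = \sum_k D 0 k * (w 0 k * Num.conj (w 0 k)).
  transitivity (map_mx f (v *m A *m v^T) 0 0); first by rewrite [RHS]mxE.
  rewrite !map_mxM -/fv -/fA fAE !mulmxA -wP -(mulmxA _ P) wE mul_mx_diag mxE.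
  by apply: eq_bigr => k _; rewrite !mxE mulrAC mulrC.
suff: f (lambda_min A * (v *m v^T) 0 0) <= f ((v *m A *m v^T) 0 0).
  by rewrite lecR.
rewrite [f (_ * _)]rmorphM [X in _ * X]normE formE mulr_sumr.
by apply: ler_sum => k _; rewrite ler_wpM2r ?mul_conjC_ge0.
Qed.

(** The difference of the two sides is the variance of [y] under the weights [p]. *)
Lemma sqr_avg_le (R : realType) (I : finType) (p y : I -> R) :
  (forall i, 0 <= p i) -> \sum_i p i = 1 ->
  (\sum_i p i * y i) ^+ 2 <= \sum_i p i * y i ^+ 2.
Proof.
move=> p0 p1; set m := \sum_i p i * y i; rewrite -subr_ge0.
suff -> : \sum_i p i * y i ^+ 2 - m ^+ 2 = \sum_i p i * (y i - m) ^+ 2.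
  by apply: sumr_ge0 => i _; rewrite mulr_ge0 ?sqr_ge0.
under [RHS]eq_bigr => i _.
  have -> : p i * (y i - m) ^+ 2
      = p i * y i ^+ 2 - 2%:R * m * (p i * y i) + m ^+ 2 * p i by ring.
  over.
rewrite big_split sumrB /= -!mulr_sumr p1 -/m; ring.
Qed.

(** Row sums 1 bound the square of each coordinate of [v *m M^T] by an average of squares; column
    sums 1 make these averages add up to the squared norm of [v]. *)
Lemma bistochastic_contract (R : realType) (d : nat) (M : 'M[R]_d)
    (v : 'rV[R]_d) :
  bistochastic M ->
  (v *m M^T *m (v *m M^T)^T) 0 0 <= (v *m v^T) 0 0.
Proof.
move=> [M0 Mr Mc].
have -> : (v *m v^T) 0 0 = \sum_i \sum_j M i j * v 0 j ^+ 2.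
  rewrite exchange_big mxE; apply: eq_bigr => j _.
  by rewrite -mulr_suml Mc mul1r mxE.
rewrite mxE; apply: ler_sum => i _; rewrite !mxE -expr2.
under eq_bigr do rewrite mxE mulrC.
exact: sqr_avg_le.
Qed.

(** The test vector [v] is an eigenvector of [X^T *m X] for the minimal eigenvalue of [X *m X^T].
    Passing to [X^T *m X] lets [M] act directly on the image of [v] under [X], where contraction
    applies. *)
Lemma lambda_min_mulmx_bistochastic (R : realType) (d : nat) (M X : 'M[R]_d) :
  (0 < d)%N -> bistochastic M ->
  lambda_min ((M *m X) *m (M *m X)^T) <= lambda_min (X *m X^T).
Proof.
move=> d0 Mb.
have symT (Y : 'M[R]_d) : (Y *m Y^T)^T = Y *m Y^T by rewrite trmx_mul trmxK.
have symT' (Y : 'M[R]_d) : (Y^T *m Y)^T = Y^T *m Y by rewrite trmx_mul trmxK.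
have [/eigenvalue_mulmxC/eigenvalueP[v vX v0] _] := lambda_minP d0 (symT X).
have vv0 : 0 < (v *m v^T) 0 0.
  have sq0 j : 0 <= v 0 j ^+ 2 by rewrite sqr_ge0.
  rewrite lt_def mxE; under eq_bigr do rewrite mxE -expr2.
  rewrite sumr_ge0 // andbT psumr_eq0 //; apply: contra v0 => /allP vv.
  apply/eqP/rowP => j; rewrite mxE; apply/eqP.
  by have := vv j (mem_index_enum j); rewrite sqrf_eq0.
rewrite -(ler_pM2r vv0).
have gramE (Y : 'M[R]_d) :
    v *m (Y^T *m Y) *m v^T = (v *m Y^T) *m (v *m Y^T)^T.
  by rewrite trmx_mul trmxK !mulmxA.
apply: (@le_trans _ _ ((v *m ((M *m X)^T *m (M *m X)) *m v^T) 0 0)); last first.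
  rewrite gramE trmx_mul mulmxA; apply: le_trans (bistochastic_contract _ Mb) _.
  by rewrite -gramE vX -scalemxAl mxE.
apply: le_trans (lambda_min_rayleigh v d0 (symT' _)).
rewrite ler_pM2r //.
(* The least eigenvalue of one Gram product of [M *m X] is an eigenvalue of the other, hence at
   least its minimum. *)
have [/eigenvalue_mulmxC lE _] := lambda_minP d0 (symT' (M *m X)).
by have [_ ->] := lambda_minP d0 (symT (M *m X)).
Qed.

Lemma le_overlap_max (R : realType) (d : nat) (B B' : basis R d) i j :
  overlap_mx B B' i j <= overlap_max B B'.
Proof.
apply: le_trans (le_bigmax _ _ i).
exact: (le_bigmax _ (fun j => overlap_mx B B' i j)).
Qed.

(** Positivity is what monotonicity of [ln] requires. The overlaps sum to the trace of the identity,
    which is [d], so they cannot all vanish. *)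
Lemma overlap_max_gt0 (R : realType) (d : nat) (B B' : basis R d) :
  (0 < d)%N -> 0 < overlap_max B B'.
Proof.
move=> d0; rewrite ltNge; apply/negP => max_le0.
have X0 i j : overlap_mx B B' i j = 0.
  apply/le_anti/andP; split; last by have [] := overlapE B B' i j.
  exact: le_trans (le_overlap_max B B' i j) max_le0.
have /eqP : \tr (1%:M : 'M[R[i]]_d) = 0.
  rewrite -[1%:M]mulmx1 -{1}(proj_sum B) -(proj_sum B') mulmx_suml raddf_sum /=.
  apply: big1 => i _; rewrite mulmx_sumr raddf_sum /=.
  by apply: big1 => j _; have [_ ->] := overlapE B B' i j; rewrite X0.
by rewrite mxtrace1 pnatr_eq0 eqn0Ngt d0.
Qed.

Lemma overlap_max_succ (R : realType) (d : nat) (B0 B1 B2 : basis R d) :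
  (0 < d)%N -> basis_succ B0 B1 B2 -> overlap_max B2 B0 <= overlap_max B1 B0.
Proof.
move=> d0 [M [[M0 Mr _] X2E]].
(* Both nested maxima start from 0, so the bound must also dominate 0. *)
have max_ge0 := ltW (overlap_max_gt0 B1 B0 d0).
apply: bigmax_le => // i _; apply: bigmax_le => // j _.
rewrite X2E mxE -[leRHS]mul1r -(Mr i) mulr_suml.
by apply: ler_sum => k _; rewrite ler_wpM2l // le_overlap_max.
Qed.

Theorem proposition4 (R : realType) (d : nat) (hd : (0 < d)%N)
    (B0 B1 B2 : basis R d) (h12 : basis_succ B0 B1 B2) :
  q B1 B0 <= q B2 B0 /\ rMU B1 B0 <= rMU B2 B0.
Proof.
split; last first.
  by rewrite lerN2 ler_ln ?posrE ?overlap_max_gt0 ?overlap_max_succ.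
have [M [Mb X2E]] := h12.
by rewrite lerD2l lerN2 X2E lambda_min_mulmx_bistochastic.
Qed.
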